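(* Let $\eta\in\mathbb{N}^n$ be a composition, let $1\le r\le n$, and let the coefficients $A^{(r)}_{\eta\lambda}=A^{(r)}_{\eta\lambda}(q,t)\in\mathbb{Q}(q,t)$ (for compositions $\lambda$ with $|\eta|+1\le|\lambda|\le|\eta|+r$) be defined by the expansion $$(e_r(z)-e_r(\overline{\eta}))\,E^*_\eta(z;q,t)=\sum_{|\eta|+1\le|\lambda|\le|\eta|+r}A^{(r)}_{\eta\lambda}\,E^*_\lambda(z;q,t).$$ Write $\lambda^i$ for a composition of modulus $|\eta|+i$. Then for $\eta\preceq'\lambda^i$ ($1\le i\le r$) the coefficients are recursively generated as $$A_{\eta\lambda^1}^{(r)}=\frac{(e_r(\overline{\lambda^1})-e_r(\overline{\eta}))E_\eta^*(\overline{\lambda^1})}{E_{\lambda^1}^*(\overline{\lambda^1})},$$ $$A_{\eta\lambda^2}^{(r)}=\frac{(e_r(\overline{\lambda^2})-e_r(\overline{\eta}))E_\eta^*(\overline{\lambda^2})}{E_{\lambda^2}^*(\overline{\lambda^2})}-\sum_{\lambda^1:\,\eta\preceq'\lambda^1\preceq'\lambda^2}A_{\eta\lambda^1}^{(r)}\frac{E^*_{\lambda^1}(\overline{\lambda^2})}{E^*_{\lambda^2}(\overline{\lambda^2})},$$ and in general $$A_{\eta\lambda^i}^{(r)}=\frac{(e_r(\overline{\lambda^i})-e_r(\overline{\eta}))E_\eta^*(\overline{\lambda^i})}{E_{\lambda^i}^*(\overline{\lambda^i})}-\sum_{k=1}^{i-1}\ \sum_{\lambda^k:\,\eta\preceq'\lambda^k\preceq'\lambda^i}A_{\eta\lambda^k}^{(r)}\frac{E^*_{\lambda^k}(\overline{\lambda^i})}{E_{\lambda^i}^*(\overline{\lambda^i})},$$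 where the inner sum is over compositions $\lambda^k$ of modulus $|\eta|+k$. If $\eta\not\preceq'\lambda^i$ then $A_{\eta\lambda^i}^{(r)}=0$.
   Context: Fix $n\ge1$ and let $q,t$ be independent indeterminates; all polynomials are in $z=(z_1,\dots,z_n)$ with coefficients in $\mathbb{Q}(q,t)$. A composition is $\eta=(\eta_1,\dots,\eta_n)\in\mathbb{N}^n$ ($0\in\mathbb{N}$), with modulus $|\eta|=\sum_i\eta_i$. Put $l'_\eta(i)=\#\{j<i:\eta_j\ge\eta_i\}+\#\{j>i:\eta_j>\eta_i\}$, $\ \overline{\eta}_i=q^{\eta_i}t^{-l'_\eta(i)}$, $\ \overline{\eta}=(\overline{\eta}_1,\dots,\overline{\eta}_n)$. $e_r(z)=\sum_{1\le i_1<\dots<i_r\le n}z_{i_1}\cdots z_{i_r}$ is the $r$-th elementary symmetric function. The interpolation Macdonald polynomial $E^*_\eta(z)=E^*_\eta(z;q,t)$ is the unique polynomial of degree $\le|\eta|$ such that $E^*_\eta(\overline{\mu})=0$ for all compositions $\mu\ne\eta$ with $|\mu|\le|\eta|$, and whose coefficient of $z^\eta=z_1^{\eta_1}\cdots z_n^{\eta_n}$ is $1$; it satisfies $E^*_\eta(\overline{\eta})\ne0$. The $E^*_\eta$ form a basis of the polynomials. Successor relation: $\eta\preceq'\lambda$ means there is a permutation $\sigma$ of $\{1,\dots,n\}$ such that $\eta_i<\lambda_{\sigma(i)}$ whenever $i<\sigma(i)$ and $\eta_i\le\lambda_{\sigma(i)}$ whenever $i\ge\sigma(i)$. *)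

(* Defs.v *)
From HB Require Import structures.
From mathcomp Require Import all_boot all_order all_fingroup all_algebra.
From mathcomp Require Import mpoly.
From Stdlib Require Import ClassicalEpsilon.

Set Implicit Arguments.
Unset Strict Implicit.
Unset Printing Implicit Defensive.

Import GRing.Theory.
Local Open Scope ring_scope.

(* The field Q(q,t), as the fraction field of Q[q,t]. *)
Definition Qqt : fieldType := {fraction {mpoly rat[2]}}.
Definition q : Qqt := @tofrac {mpoly rat[2]} 'X_ord0.
Definition t : Qqt := @tofrac {mpoly rat[2]} 'X_ord_max.

(* Compositions with n parts are multinomials 'X_{1..n}; mdeg is the modulus. *)

Definition leg_colength (n : nat) (eta : 'X_{1..n}) (i : 'I_n) : nat :=
  (#|[set j : 'I_n | (j < i) && (eta i <= eta j)]|
   + #|[set j : 'I_n | (i < j) && (eta i < eta j)]|)%N.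

Definition spectral (n : nat) (eta : 'X_{1..n}) : 'I_n -> Qqt :=
  fun i => q ^+ eta i * t ^- leg_colength eta i.

(* msize p = deg p + 1 for p != 0, so the first clause says deg p <= |eta|. *)
Definition is_interp_macdonald (n : nat) (eta : 'X_{1..n})
    (p : {mpoly Qqt[n]}) : Prop :=
  [/\ (msize p <= (mdeg eta).+1)%N,
      forall mu : 'X_{1..n}, mu != eta -> (mdeg mu <= mdeg eta)%N ->
        p.@[spectral mu] = 0
    & p@_eta = 1].

(* E^*_eta: exactly one polynomial satisfies is_interp_macdonald eta. *)
Definition interp_macdonald (n : nat) (eta : 'X_{1..n}) : {mpoly Qqt[n]} :=
  epsilon (inhabits 0) (is_interp_macdonald eta).

(* The successor relation eta <=' lambda. *)
Definition succ_rel (n : nat) (eta lambda : 'X_{1..n}) : bool :=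
  [exists s : 'S_n, [forall i : 'I_n,
    if (i < s i)%N then (eta i < lambda (s i))%N
    else (eta i <= lambda (s i))%N]].

(* Only the values A lambda with |eta| + 1 <= |lambda| <= |eta| + r are
   constrained. *)
Definition is_pieri_expansion (n r : nat) (eta : 'X_{1..n})
    (A : 'X_{1..n} -> Qqt) : Prop :=
  (mesym n Qqt r - ((mesym n Qqt r).@[spectral eta])%:MP) * interp_macdonald eta
  = \sum_(lambda : 'X_{1..n < (mdeg eta + r).+1} | (mdeg eta + 1 <= mdeg lambda)%N)
      A lambda *: interp_macdonald lambda.

(* Main.v *)
From HB Require Import structures.
Require Import Defs.
From mathcomp Require Import all_boot all_order all_fingroup all_algebra.
From mathcomp Require Import mpoly.
From Stdlib Require Import ClassicalEpsilon.
From mathcomp Require Import ring zify.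
Import GRing.Theory.
Local Open Scope ring_scope.
Set Implicit Arguments.
Unset Strict Implicit.
Unset Printing Implicit Defensive.

(** Everything rests on evaluating the expansion at spectral points.  Evaluated
at the point of a composition [lambda] of modulus [|eta| + i], the terms indexed
by compositions of modulus at least [|lambda|] vanish, except the one indexed by
[lambda] itself.  The coefficients therefore satisfy a triangular system
([pieri_triangular]).  Solving it by recursion gives the formulas, once it is
known that [E_mu] vanishes at the point of [lambda] unless [mu <=' lambda]
([interp_macdonald_extra_vanishing]); this also restricts the inner sums, since
[<='] is transitive.

The polynomials [E_eta] must first be shown to exist and not to vanish at their
own points.  Both facts say that certain square matrices over [Q(q,t)], with
rows indexed by monomials and columns by points, are invertible.  After denominators
are cleared, their entries are polynomials in [q] and [t], so it is enough that
the determinants are nonzero at [q = 2], [t = 1].  There the spectral points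
become the grid points [(2 ^ mu_1, ..., 2 ^ mu_n)], and the products of
[z_i - 2 ^ k] for [k < nu_i] make the system triangular ([newton_grid_det]).

The extra vanishing uses the inhomogeneous Cherednik operators
[Xi_i = z_i ^ -1 (t ^ (n - 1) + H_i ... H_{n-1} Phi H_1 ... H_{i-1})],
in which [H_j] is a Hecke operator in the variables [z_j], [z_{j+1}] and [Phi]
rotates the variables and multiplies by a linear factor.
The bracket vanishes at [z_i = 0], so [Xi_i] does
not raise degrees.  At a spectral point, the value of each [H_j f] depends only on
the values of [f] at this point and at the one with parts [j] and [j + 1] exchanged,
and the value of [Phi f] only on the value of [f] at the composition with one box
less, or is zero.  Hence the value of [Xi_i f] at the point of [lambda] is the
scalar [t ^ (n - 1) / lambda_i] times that of [f] ([lambda_i] being the [i]-th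
coordinate of the point), plus a combination of values of
[f] at points of predecessors [mu <=' lambda] with [|mu| = |lambda| - 1]
([cherednik_word_spectral_neq0]).  By uniqueness of interpolation, [E_eta] is then
an eigenvector of every [Xi_i] ([interp_macdonald_eigen]).  If it does not vanish
at [lambda], distinct from [eta], then some [i] separates the eigenvalue from
[t ^ (n - 1) / lambda_i], so [E_eta] does not vanish at some predecessor
of [lambda]; induction on [|lambda|] and transitivity finish the proof. *)

(** * Degrees and evaluation *)

Lemma msizeM_leq n (F : fieldType) (f g : {mpoly F[n]}) a b :
  (msize f <= a.+1)%N -> (msize g <= b)%N -> (msize (f * g) <= a + b)%N.
Proof.
have [->|nz_f] := eqVneq f 0; first by rewrite mul0r msize0.
have [->|nz_g] := eqVneq g 0; first by rewrite mulr0 msize0.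
by move=> hf hg; rewrite msizeM // -ltnS prednK ?addn_gt0 ?lt0n ?msize_poly_eq0
  ?nz_f // -addSn leq_add.
Qed.

Lemma msizeB_leq n (R : nzRingType) (f g : {mpoly R[n]}) d :
  (msize f <= d)%N -> (msize g <= d)%N -> (msize (f - g) <= d)%N.
Proof.
move=> hf hg; apply: leq_trans (msizeD_le _ _) _.
by rewrite msizeN geq_max hf hg.
Qed.

Lemma msizeD_leq n (R : nzRingType) (f g : {mpoly R[n]}) d :
  (msize f <= d)%N -> (msize g <= d)%N -> (msize (f + g) <= d)%N.
Proof. by move=> hf hg; apply: leq_trans (msizeD_le _ _) _; rewrite geq_max hf hg. Qed.

Lemma msize_sum_leq n (R : nzRingType) (I : Type) (s : seq I) (P : pred I)
    (f : I -> {mpoly R[n]}) d :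
  (forall i, P i -> (msize (f i) <= d)%N) -> (msize (\sum_(i <- s | P i) f i) <= d)%N.
Proof.
move=> h; elim/big_rec: _ => [|i g Pi IH]; first by rewrite msize0.
by apply: msizeD_leq => //; apply: h.
Qed.

Lemma meval_msum n (R : comNzRingType) (v : 'I_n -> R) (p : {mpoly R[n]}) d :
  (msize p <= d)%N ->
  p.@[v] = \sum_(m : 'X_{1..n < d}) p@_m * \prod_i v i ^+ m i.
Proof.
move=> h; rewrite {1}(mpolywE h) raddf_sum /=.
by apply: eq_bigr => m _; rewrite mevalZ mevalX.
Qed.

(** * Finite square systems *)

Section SquareSystem.
Variables (F : fieldType) (T : finType).

(** Rows and columns are indexed by a finite type, so that a system can be indexed by
compositions. *)
Definition system_mx (M : T -> T -> F) : 'M[F]_#|T| :=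
  \matrix_(i, j) M (enum_val i) (enum_val j).

Lemma det_system_neq0 (M : T -> T -> F) :
  (forall a : T -> F, (forall x, \sum_y M x y * a y = 0) -> forall y, a y = 0) ->
  \det (system_mx M) != 0.
Proof.
move=> h; rewrite -det_tr; apply/negP => /det0P [v nz_v hv].
case/negP: nz_v; apply/eqP/rowP => i; rewrite mxE.
have := h (fun y => v 0 (enum_rank y)) _ (enum_val i).
rewrite enum_valK; apply => x.
have := congr1 (fun A : 'M_(1, _) => A 0 (enum_rank x)) hv.
rewrite !mxE => {2}<-.
rewrite (reindex_omap enum_val (fun y => Some (enum_rank y))) /=; last first.
  by move=> j _; rewrite enum_rankK.
apply: eq_big => [j|j _]; first by rewrite enum_valK eqxx.
by rewrite !mxE enum_rankK enum_valK mulrC.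
Qed.

Lemma big_enum_val_all (f : T -> F) :
  \sum_x f x = \sum_(i < #|T|) f (enum_val i).
Proof. by rewrite big_enum_val. Qed.

Lemma system_solvable (M : T -> T -> F) : \det (system_mx M) != 0 ->
  forall b : T -> F, exists c : T -> F, forall y, \sum_x c x * M x y = b y.
Proof.
move=> hdet b; have hu : system_mx M \in unitmx by rewrite unitmxE unitfE.
pose c : 'rV_#|T| := (\row_j b (enum_val j)) *m invmx (system_mx M).
exists (fun x => c 0 (enum_rank x)) => y.
have /(congr1 (fun A : 'M_(1, _) => A 0 (enum_rank y))) :
  c *m system_mx M = \row_j b (enum_val j) by rewrite mulmxKV.
rewrite !mxE enum_rankK => <-; rewrite big_enum_val_all.
by apply: eq_bigr => i _; rewrite !mxE enum_valK enum_rankK.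
Qed.

Lemma system_inj (M : T -> T -> F) : \det (system_mx M) != 0 ->
  forall c : T -> F, (forall y, \sum_x c x * M x y = 0) -> forall x, c x = 0.
Proof.
move=> hdet c hc x; have hu : system_mx M \in unitmx by rewrite unitmxE unitfE.
pose v : 'rV_#|T| := \row_j c (enum_val j).
suff /(congr1 (fun A : 'M_(1, _) => A 0 (enum_rank x))): v = 0.
  by rewrite !mxE enum_rankK.
rewrite -(mulmxK hu v); suff -> : v *m system_mx M = 0 by rewrite mul0mx.
apply/rowP => j; rewrite !mxE -[RHS](hc (enum_val j)) big_enum_val_all.
by apply: eq_bigr => i _; rewrite !mxE.
Qed.

End SquareSystem.

(** * Interpolation on a product grid *)

Section Newton.
Variables (F : fieldType) (n : nat) (x : nat -> F).
Hypothesis x_inj : injective x.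

Definition newton (nu : 'X_{1..n}) : {mpoly F[n]} :=
  \prod_(i < n) \prod_(k < nu i) ('X_i - (x k)%:MP).

Lemma newton_eval (nu mu : 'X_{1..n}) :
  (newton nu).@[fun i => x (mu i)] = \prod_(i < n) \prod_(k < nu i) (x (mu i) - x k).
Proof.
rewrite rmorph_prod; apply: eq_bigr => i _; rewrite rmorph_prod.
by apply: eq_bigr => k _; rewrite /= mevalB mevalXU mevalC.
Qed.

Lemma newton_eval_diag (nu : 'X_{1..n}) : (newton nu).@[fun i => x (nu i)] != 0.
Proof.
rewrite newton_eval; apply/prodf_neq0 => i _; apply/prodf_neq0 => k _.
rewrite subr_eq0; apply/eqP => /x_inj h.
by have := ltn_ord k; rewrite -h ltnn.
Qed.

Lemma newton_eval_eq0 (nu mu : 'X_{1..n}) : (exists i, (mu i < nu i)%N) ->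
  (newton nu).@[fun i => x (mu i)] = 0.
Proof.
case=> i hi; rewrite newton_eval (bigD1 i) //= (bigD1 (Ordinal hi)) //=.
by rewrite subrr !mul0r.
Qed.

(** The monomial need not be extremal for any order: only the total degree of
the remainder counts. *)
Definition has_leading_monomial (p : {mpoly F[n]}) (m : 'X_{1..n}) :=
  (msize (p - 'X_[m]) <= mdeg m)%N.

Lemma msize_of_leading p m : has_leading_monomial p m -> (msize p <= (mdeg m).+1)%N.
Proof.
move=> h; rewrite -(subrK 'X_[m] p); apply: msizeD_leq; first exact: leqW.
by rewrite msizeX.
Qed.

Lemma leading_mul p1 m1 p2 m2 :
  has_leading_monomial p1 m1 -> has_leading_monomial p2 m2 ->
  has_leading_monomial (p1 * p2) (m1 + m2)%MM.
Proof.
move=> h1 h2; have h1' := msize_of_leading h1; rewrite /has_leading_monomial mpolyXD mdegD.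
have -> : p1 * p2 - 'X_[m1] * 'X_[m2] =
   p1 * (p2 - 'X_[m2]) + (p1 - 'X_[m1]) * 'X_[m2] by ring.
apply: msizeD_leq; first exact: msizeM_leq.
by rewrite mulrC addnC; apply: msizeM_leq => //; rewrite msizeX.
Qed.

Lemma leading_newton nu : has_leading_monomial (newton nu) nu.
Proof.
have h1 : has_leading_monomial 1 0%MM by rewrite /has_leading_monomial mpolyX0 subrr msize0.
rewrite {2}(multinomUE_id nu) /newton.
apply: (big_ind2 has_leading_monomial) => // [p1 m1 p2 m2|i _]; first exact: leading_mul.
elim: (nu i) => [|k IH]; first by rewrite big_ord0.
rewrite big_ord_recr mulmSr; apply: leading_mul => //=.
rewrite /has_leading_monomial mdeg1 addrAC subrr sub0r msizeN.
by rewrite msizeC; case: (_ != 0).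
Qed.

Lemma newton_msize nu : (msize (newton nu) <= (mdeg nu).+1)%N.
Proof. exact/msize_of_leading/leading_newton. Qed.

Lemma newton_coeff nu eta : mdeg eta = mdeg nu ->
  (newton nu)@_eta = (nu == eta)%:R.
Proof.
move=> h; have := leading_newton nu; rewrite /has_leading_monomial -h => /msize_mdeg_ge.
move/memN_msupp_eq0/eqP; rewrite mcoeffB subr_eq0 => /eqP ->.
by rewrite mcoeffX.
Qed.

Lemma mnm_eq_of_le (nu mu : 'X_{1..n}) :
  (forall i, nu i <= mu i)%N -> (mdeg mu <= mdeg nu)%N -> nu = mu.
Proof.
move=> h hd; apply/mnmP => i; apply/eqP; rewrite eqn_leq h /= leqNgt.
apply/negP => hlt; move: hd; rewrite leqNgt => /negP; apply.
rewrite !mdegE (bigD1 i) //= [X in (_ < X)%N](bigD1 i) //=.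
by rewrite -addSn leq_add // leq_sum.
Qed.

(** Value on the monomial [nu] of the linear form attached to [mu]: evaluation at
the point of [mu], or, for the single index selected by [o], extraction of the
coefficient of [mu].  The first kind alone expresses uniqueness of interpolation;
with one form of the second kind the system asks for a polynomial normalised by
a coefficient, as in the definition of [E_eta]. *)
Definition functional_on_mono (o : option 'X_{1..n}) (pt : 'X_{1..n} -> 'I_n -> F)
  (nu mu : 'X_{1..n}) : F :=
  if o == Some mu then (nu == mu)%:R else \prod_i pt mu i ^+ nu i.

(** A Newton polynomial vanishes at every grid point whose index does not dominate its
own, so testing a linear relation between the columns against all Newton
polynomials kills its coefficients one after the other, starting from the highest
degree.  A coefficient form is harmless because it sits in the top degree [d], where
a Newton polynomial has only its leading monomial. *)
Lemma newton_grid_det (d : nat) (o : option 'X_{1..n}) :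
  (forall eta, o = Some eta -> mdeg eta = d) ->
  \det (system_mx (fun nu mu : 'X_{1..n < d.+1} =>
     functional_on_mono o (fun mu i => x (mu i)) nu mu)) != 0.
Proof.
move=> ho; apply: det_system_neq0 => a ha.
pose L (p : {mpoly F[n]}) (mu : 'X_{1..n}) :=
  if o == Some mu then p@_mu else p.@[fun i => x (mu i)].
have hL p : (msize p <= d.+1)%N ->
    \sum_(mu : 'X_{1..n < d.+1}) L p mu * a mu = 0.
  move=> hp; transitivity (\sum_(nu : 'X_{1..n < d.+1}) p@_nu *
     \sum_(mu : 'X_{1..n < d.+1})
        functional_on_mono o (fun mu i => x (mu i)) nu mu * a mu); last first.
    by rewrite big1 // => nu _; rewrite ha mulr0.
  under [RHS]eq_bigr => nu _ do rewrite mulr_sumr.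
  rewrite exchange_big; apply: eq_bigr => mu _ /=.
  under eq_bigr => nu _ do rewrite mulrA.
  rewrite -mulr_suml; congr (_ * _); rewrite /L /functional_on_mono.
  case: ifP => _; last by rewrite (meval_msum _ hp).
  rewrite (bigD1 mu) //= eqxx mulr1 big1 ?addr0 // => nu hnu.
  by rewrite (_ : (_ == _) = false) ?mulr0 //; apply/negbTE.
(* Downward induction on the degree of [mu]. *)
suff main k : forall mu : 'X_{1..n < d.+1}, (d - mdeg mu = k)%N -> a mu = 0.
  by move=> mu; apply: main erefl.
elim/ltn_ind: k => k IH mu hk; have hmu := bmdeg mu.
have := hL (newton mu) (leq_trans (newton_msize mu) hmu).
rewrite (bigD1 mu) //= big1 ?addr0 => [|nu hnu]; last first.
  have hnud := bmdeg nu.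
  have [hle|hgt] := leqP (mdeg nu) (mdeg mu); last first.
    by rewrite (IH (d - mdeg nu)%N _ nu) ?mulr0 //; lia.
  rewrite (_ : L _ _ = 0) ?mul0r // /L.
  case: ifP => [/eqP/ho hn|_].
    rewrite newton_coeff; last by lia.
    by rewrite (_ : (_ == _) = false) // eq_sym; apply/negbTE.
  apply: newton_eval_eq0; apply/existsP; rewrite -[X in is_true X]negbK.
  rewrite negb_exists; apply/negP => /forallP h.
  case/negP: hnu; apply/eqP/val_inj => /=; apply/esym/mnm_eq_of_le => [i|//].
  by rewrite leqNgt.
move/eqP; rewrite mulf_eq0 => /orP[|/eqP//]; rewrite /L.
case: ifP => _; last by rewrite (negbTE (newton_eval_diag _)).
by rewrite newton_coeff // eqxx oner_eq0.
Qed.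

End Newton.

(** * Specialisation of the parameters at q = 2 and t = 1 *)

Definition specialize (f : {mpoly rat[2]}) : rat :=
  f.@[fun i => if i == ord0 then 2 else 1].

HB.instance Definition _ := GRing.RMorphism.copy specialize specialize.

(** A name for [tofrac] whose codomain is [Qqt], so that the operations of that
field are found on the images. *)
Definition frac (f : {mpoly rat[2]}) : Qqt := @tofrac {mpoly rat[2]} f.
HB.instance Definition _ := GRing.RMorphism.copy frac frac.

Lemma frac_eq0 f : (frac f == 0) = (f == 0).
Proof. exact: tofrac_eq0. Qed.

Lemma specialize_neq0 f : specialize f != 0 -> frac f != 0.
Proof. by apply: contraNneq => /eqP; rewrite frac_eq0 => /eqP ->; rewrite rmorph0. Qed.

Lemma specialize_q : specialize 'X_ord0 = 2. Proof. exact: mevalXU. Qed.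
Lemma specialize_t : specialize 'X_ord_max = 1. Proof. exact: mevalXU. Qed.

Lemma q_neq0 : q != 0.
Proof. by apply: (@specialize_neq0 'X_ord0); rewrite specialize_q. Qed.

Lemma t_neq0 : t != 0.
Proof. by apply: (@specialize_neq0 'X_ord_max); rewrite specialize_t. Qed.

Lemma t_neq1 : t - 1 != 0.
Proof.
rewrite -[t]/(frac 'X_ord_max) -(rmorph1 frac) -rmorphB frac_eq0.
apply/negP => /eqP/(congr1 (mcoeff U_(ord_max))); rewrite mcoeffB mcoeffXU eqxx.
by rewrite mcoeff1 mnm1_eq0 subr0 mcoeff0 => /eqP; rewrite oner_eq0.
Qed.

Lemma pow2_inj : injective (fun k : nat => (2 : rat) ^+ k).
Proof. exact: Num.Theory.ieexprIn. Qed.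

Lemma t_expr_neq0 k : t ^+ k != 0.
Proof. by rewrite expf_neq0 ?t_neq0. Qed.

(** The power of [q] can be read off after specialising [t] to [1], which erases
the powers of [t]. *)
Lemma q_expr_inj a b c d : q ^+ a * t ^- b = q ^+ c * t ^- d -> a = c.
Proof.
move=> /(congr1 (fun x => x * (t ^+ b * t ^+ d))) h; apply: pow2_inj => /=.
have {h} : q ^+ a * t ^+ d = q ^+ c * t ^+ b.
  move: h; rewrite mulrA mulfVK ?t_expr_neq0 // => ->.
  by rewrite [t ^+ b * _]mulrC mulrA mulfVK ?t_expr_neq0.
rewrite -[q]/(frac 'X_ord0) -[t]/(frac 'X_ord_max) -!rmorphXn -!rmorphM.
move/eqP; rewrite -subr_eq0 -rmorphB frac_eq0 subr_eq0 => /eqP.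
move/(congr1 specialize); rewrite !rmorphM !rmorphXn /=.
by rewrite specialize_q specialize_t !expr1n !mulr1.
Qed.

(** * Interpolation at the spectral points *)

Section Unisolvence.
Variables (n d : nat) (o : option 'X_{1..n}).
Hypothesis ho : forall eta, o = Some eta -> mdeg eta = d.

Lemma leg_colength_le (mu : 'X_{1..n}) i : (leg_colength mu i <= n + n)%N.
Proof.
apply: leq_add; rewrite -[X in (_ <= X)%N](card_ord n); exact: max_card.
Qed.

(** Multiplying the row of [nu] by [t ^ ((n + n) * |nu|)] replaces each exponent
[- leg_colength] by [n + n - leg_colength], which is nonnegative by the crude bound
[leg_colength_le]. *)
Definition cleared_system (nu mu : 'X_{1..n < d.+1}) : {mpoly rat[2]} :=
  if o == Some (mu : 'X_{1..n}) then (nu == mu)%:R * 'X_ord_max ^+ ((n + n) * mdeg nu)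
  else \prod_i ('X_ord0 ^+ mu i * 'X_ord_max ^+ (n + n - leg_colength mu i)) ^+ nu i.

Lemma cleared_systemE (nu mu : 'X_{1..n < d.+1}) :
  frac (cleared_system nu mu) =
  t ^+ ((n + n) * mdeg nu) * functional_on_mono o (@spectral n) nu mu.
Proof.
rewrite /cleared_system /functional_on_mono; case: ifP => _.
  by rewrite rmorphM rmorph_nat rmorphXn mulrC.
rewrite mdegE big_distrr expr_sum -big_split rmorph_prod /=.
apply: eq_bigr => i _; rewrite exprM -exprMn rmorphXn; congr (_ ^+ _).
rewrite rmorphM !rmorphXn /spectral mulrCA; congr (_ * _).
by rewrite /= -[frac _]/t -{2}(subnK (leg_colength_le mu i)) exprD mulfK
  ?t_expr_neq0.
Qed.

(** At [q = 2], [t = 1] this is the system of the grid of powers of [2]. *)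
Lemma det_cleared_system : \det (system_mx (F := Qqt)
  (fun nu mu => frac (cleared_system nu mu))) != 0.
Proof.
pose M : 'M_#|{: 'X_{1..n < d.+1}}| :=
  \matrix_(i, j) cleared_system (enum_val i) (enum_val j).
rewrite (_ : system_mx _ = map_mx frac M); last by apply/matrixP => i j; rewrite !mxE.
rewrite det_map_mx; apply: specialize_neq0; rewrite -det_map_mx.
have := newton_grid_det pow2_inj ho; congr (\det _ != 0).
apply/matrixP => i j; rewrite !mxE /cleared_system /functional_on_mono.
case: ifP => _.
  by rewrite rmorphM rmorphXn rmorph_nat /= specialize_t expr1n mulr1.
rewrite rmorph_prod; apply: eq_bigr => k _.
by rewrite rmorphXn rmorphM !rmorphXn /= specialize_t specialize_q expr1n mulr1.
Qed.

Lemma spectral_solvable (b : 'X_{1..n} -> Qqt) : exists p : {mpoly Qqt[n]},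
  (msize p <= d.+1)%N /\ forall mu : 'X_{1..n}, (mdeg mu <= d)%N ->
    (if o == Some mu then p@_mu else p.@[spectral mu]) = b mu.
Proof.
have [c hc] := system_solvable det_cleared_system (fun mu => b mu).
pose c' (nu : 'X_{1..n < d.+1}) := c nu * t ^+ ((n + n) * mdeg nu).
pose p : {mpoly Qqt[n]} := \sum_(nu : 'X_{1..n < d.+1}) c' nu *: 'X_[nu].
exists p; split.
  apply: msize_sum_leq => nu _; apply: leq_trans (msizeZ_le _ _) _.
  by rewrite msizeX; apply: bmdeg.
move=> mu; rewrite -ltnS => hmu; rewrite -(hc (BMultinom hmu)).
transitivity (\sum_(nu : 'X_{1..n < d.+1})
    c' nu * functional_on_mono o (@spectral n) nu mu); last first.
  by apply: eq_bigr => nu _; rewrite cleared_systemE mulrA.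
rewrite /p /functional_on_mono; case: ifP => _.
  by rewrite raddf_sum; apply: eq_bigr => nu _; rewrite /= mcoeffZ mcoeffX.
by rewrite raddf_sum; apply: eq_bigr => nu _; rewrite /= mevalZ mevalX.
Qed.

Lemma spectral_unique (p : {mpoly Qqt[n]}) : (msize p <= d.+1)%N ->
  (forall mu : 'X_{1..n}, (mdeg mu <= d)%N ->
    (if o == Some mu then p@_mu else p.@[spectral mu]) = 0) -> p = 0.
Proof.
move=> hp h; pose c (nu : 'X_{1..n < d.+1}) := p@_nu / t ^+ ((n + n) * mdeg nu).
have hc : forall nu, c nu = 0.
  apply: (system_inj det_cleared_system) => mu.
  rewrite -[RHS](h mu) -1?ltnS ?bmdeg //.
  transitivity (\sum_(nu : 'X_{1..n < d.+1})
    p@_nu * functional_on_mono o (@spectral n) nu mu).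
    by apply: eq_bigr => nu _; rewrite cleared_systemE mulrA mulfVK ?t_expr_neq0.
  rewrite /functional_on_mono; case: ifP => _; last by rewrite (meval_msum _ hp).
  rewrite (bigD1 mu) //= eqxx mulr1 big1 ?addr0 // => nu hnu.
  by rewrite (_ : (_ == _) = false) ?mulr0 //; apply/negbTE.
rewrite (mpolywE hp) big1 // => nu _; have /eqP := hc nu.
by rewrite mulf_eq0 invr_eq0 (negbTE (t_expr_neq0 _)) orbF => /eqP ->; rewrite scale0r.
Qed.

End Unisolvence.

Lemma poly_eq0_of_spectral n d (p : {mpoly Qqt[n]}) : (msize p <= d.+1)%N ->
  (forall mu : 'X_{1..n}, (mdeg mu <= d)%N -> p.@[spectral mu] = 0) -> p = 0.
Proof. by apply: (@spectral_unique _ d None). Qed.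

Lemma interp_macdonaldP n (eta : 'X_{1..n}) :
  is_interp_macdonald eta (interp_macdonald eta).
Proof.
rewrite /interp_macdonald; apply: epsilon_spec.
have ho : forall eta', Some eta = Some eta' -> mdeg eta' = mdeg eta by move=> ? [<-].
have [p [hp h]] := spectral_solvable ho (fun mu => (mu == eta)%:R).
exists p; split=> // [mu hmu hdeg|].
  have := h mu hdeg; rewrite (negbTE hmu).
  by rewrite (_ : (_ == _) = false) //; apply: contraNF hmu => /eqP [->].
by have := h eta (leqnn _); rewrite !eqxx.
Qed.

(** Otherwise [E_eta] would vanish at all points of modulus at most [|eta|], hence
be zero, although it has a coefficient [1]. *)
Lemma interp_macdonald_neq0 n (eta : 'X_{1..n}) :
  (interp_macdonald eta).@[spectral eta] != 0.
Proof.
have [hs h0 h1] := interp_macdonaldP eta; apply/negP => /eqP h.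
suff hE : interp_macdonald eta = 0.
  by move/eqP: h1; rewrite hE mcoeff0 eq_sym oner_eq0.
apply: (poly_eq0_of_spectral hs) => mu hmu.
by have [->|hne] := eqVneq mu eta; last exact: h0.
Qed.

(** * Spectral points of related compositions *)

(** The two sets counted by [leg_colength] merged into one: the indices ranked before
[i] when the parts are sorted decreasingly, ties broken from left to right.  The
effect of moving parts around is clearer on this form. *)
Definition dominators n (mu : 'X_{1..n}) (i : 'I_n) : {set 'I_n} :=
  [set j | (mu i < mu j)%N || (mu i == mu j) && (j < i)%N].

Lemma leg_colengthE n (mu : 'X_{1..n}) i : leg_colength mu i = #|dominators mu i|.
Proof.
rewrite /leg_colength -cardsUI [X in (_ + X)%N](_ : _ = 0%N) ?addn0; last first.
  by apply/eqP; rewrite cards_eq0; apply/eqP/setP => j; rewrite !inE; lia.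
apply: eq_card => j; rewrite !inE.
have [-> | hij] := eqVneq j i; first by lia.
have : (nat_of_ord j != i) by []; lia.
Qed.

Lemma leg_colength_transport n (mu nu : 'X_{1..n}) (f : 'I_n -> 'I_n) :
  injective f ->
  (forall i j, (j \in dominators nu i) = (f j \in dominators mu (f i))) ->
  forall i, leg_colength nu i = leg_colength mu (f i).
Proof.
move=> f_inj h i; rewrite !leg_colengthE.
rewrite (_ : dominators nu i = f @^-1: dominators mu (f i)).
  by rewrite on_card_preimset //; apply: onW_bij; exact: injF_bij.
by apply/setP => j; rewrite [RHS]inE -h.
Qed.

Definition permute n (mu : 'X_{1..n}) (s : 'S_n) : 'X_{1..n} :=
  [multinom mu (s i) | i < n].

Section Rank.
Variable m : nat.
Implicit Types (mu nu la : 'X_{1..m.+1}) (p : {mpoly Qqt[m.+1]}).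

Definition pos (j : nat) : 'I_m.+1 := inord j.
Definition adjacent (j : nat) : 'S_m.+1 := tperm (pos j) (pos j.+1).

Lemma adjacentE j (k : 'I_m.+1) : (j < m)%N ->
  adjacent j k = (if k == j :> nat then j.+1 else if k == j.+1 :> nat then j else k) :> nat.
Proof.
move=> hj; have hp : pos j = j :> nat by rewrite inordK //; lia.
have hp1 : pos j.+1 = j.+1 :> nat by rewrite inordK //; lia.
rewrite /adjacent; case: tpermP => [->|->|h1 h2].
- by rewrite hp hp1 eqxx.
- by rewrite hp hp1 eqxx; case: ifP => //; lia.
case: ifP => [/eqP h|_]; first by case: h1; apply: val_inj; rewrite /= hp.
by case: ifP => [/eqP h|//]; case: h2; apply: val_inj; rewrite /= hp1.
Qed.

Lemma adjacent_id j (k : 'I_m.+1) : (j < m)%N -> (k != j :> nat) -> (k != j.+1 :> nat) -> adjacent j k = k.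
Proof.
move=> hj h1 h2; apply: val_inj; rewrite /= adjacentE //.
by rewrite (negbTE h1) (negbTE h2).
Qed.

Lemma posE j : (j <= m)%N -> pos j = j :> nat.
Proof. by move=> h; rewrite inordK. Qed.

(** Exchanging two adjacent parts preserves the order of the positions of any other
pair of parts, and distinct parts are never compared by position. *)
Lemma spectral_adjacent mu j : (j < m)%N -> mu (pos j) != mu (pos j.+1) ->
  forall i, spectral (permute mu (adjacent j)) i = spectral mu (adjacent j i).
Proof.
move=> hj hne i; rewrite /spectral mnmE; congr (_ * _ ^- _).
apply: leg_colength_transport => [|{}i k]; first exact: perm_inj.
rewrite !inE !mnmE; congr (_ || _).
case: eqP => //= heq; rewrite !adjacentE //.
have hp : pos j = j :> nat by apply: posE; lia.
have hp1 : pos j.+1 = j.+1 :> nat by apply: posE.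
have hbad (x y : 'I_m.+1) : mu (adjacent j x) = mu (adjacent j y) ->
    x = j :> nat -> y = j.+1 :> nat -> False.
  move=> hxy hx hy; move: hxy hne.
  have -> : x = pos j by apply: val_inj; rewrite /= hp.
  have -> : y = pos j.+1 by apply: val_inj; rewrite /= hp1.
  by rewrite /adjacent tpermL tpermR => ->; rewrite eqxx.
have h1 := hbad _ _ heq; have h2 := hbad _ _ (esym heq).
by do ?case: ifP => /eqP; lia.
Qed.

(** This relation is exactly where [hecke] reduces to a scalar, see
[hecke_eval_eq]. *)
Lemma spectral_adjacent_eq mu j : (j < m)%N -> mu (pos j) = mu (pos j.+1) ->
  spectral mu (pos j) = t * spectral mu (pos j.+1).
Proof.
move=> hj heq; rewrite /spectral heq mulrCA; congr (_ * _).
have hp : pos j = j :> nat by apply: posE; lia.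
have hp1 : pos j.+1 = j.+1 :> nat by apply: posE.
suff -> : leg_colength mu (pos j.+1) = (leg_colength mu (pos j)).+1.
  by rewrite exprS invfM mulrA mulfV ?t_neq0 // mul1r.
have hnot : pos j \notin dominators mu (pos j) by rewrite !inE; lia.
have := cardsU1 (pos j) (dominators mu (pos j)); rewrite hnot add1n !leg_colengthE => <-.
apply: eq_card => k; rewrite !inE -heq -(inj_eq val_inj) /= hp hp1.
have [->|] := eqVneq k (pos j); first by rewrite hp; lia.
rewrite -(inj_eq val_inj) /= hp; lia.
Qed.

Lemma ord_predE (i : 'I_m.+1) : ord_pred i = (if i == ord0 then m else i.-1) :> nat.
Proof.
case: i => [[|i] hi] /=; first by rewrite modn_small.
by rewrite modnDr modn_small // ltnW.
Qed.

(** Moves the last part to the front and removes one box from it.  This is the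
inverse of the raising map [(eta_1, ..., eta_n) |-> (eta_2, ..., eta_n, eta_1 + 1)];
since the truncated subtraction is harmless only for a positive last part, the
lemmas assume one. *)
Definition lower nu : 'X_{1..m.+1} :=
  [multinom (nu (ord_pred i) - (i == ord0))%N | i < m.+1].

Lemma ord_pred0 : ord_pred ord0 = ord_max :> 'I_m.+1.
Proof. by apply: val_inj; apply: etrans (ord_predE _) _. Qed.

Lemma mdeg_lower nu : (0 < nu ord_max)%N -> mdeg nu = (mdeg (lower nu)).+1.
Proof.
move=> h; rewrite !mdegE (reindex_inj (@ord_pred_inj m.+1)) /=.
rewrite (bigD1 ord0) //= [X in _ = X.+1](bigD1 ord0) //= mnmE eqxx ord_pred0.
rewrite -addSn -subSn // subn1; congr (_ + _)%N.
by apply: eq_bigr => i hi; rewrite mnmE (negbTE hi) subn0.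
Qed.

Lemma spectral_lower nu : (0 < nu ord_max)%N -> forall i,
  spectral (lower nu) i = spectral nu (ord_pred i) * q ^- (i == ord0).
Proof.
move=> hpos i; rewrite /spectral mnmE mulrAC; congr (_ * _); last first.
  congr (_ ^- _); apply: leg_colength_transport => [|{}i k]; first exact: ord_pred_inj.
  rewrite !inE !mnmE -![(_ < ord_pred _)%N]/(nat_of_ord _ < nat_of_ord _)%N !ord_predE.
  have [->|hi] := eqVneq i ord0; have [->|hk] := eqVneq k ord0 => //=.
  - by rewrite ord_pred0; lia.
  - have := ltn_ord k; have : nat_of_ord k != 0%N by [].
    rewrite ord_pred0; lia.
  - have := ltn_ord i; have : nat_of_ord i != 0%N by [].
    rewrite ord_pred0; lia.
  - have : nat_of_ord i != 0%N by []. have : nat_of_ord k != 0%N by [].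
    lia.
have [->|hi] := eqVneq i ord0; last by rewrite subn0 expr0 invr1 mulr1.
rewrite ord_pred0 expr1 -{2}(subnK hpos) addn1 exprSr mulfK ?q_neq0 //.
Qed.

(** A zero last part has every other part ranked before it, which makes the last
coordinate the root of the linear factor of [raise]. *)
Lemma spectral_last0 nu : nu ord_max = 0%N -> spectral nu ord_max = t ^- m.
Proof.
move=> h; rewrite /spectral h expr0 mul1r leg_colengthE; congr (_ ^- _).
rewrite (_ : dominators _ _ = [set~ ord_max]) ?cardsC1 ?card_ord //.
apply/setP => j; rewrite !inE h; have [->|hj] := eqVneq j ord_max.
  by rewrite h /= ltnn.
have : nat_of_ord j != m by [].
by have := ltn_ord j; rewrite /=; lia.
Qed.

End Rank.

Lemma succ_rel_refl n (eta : 'X_{1..n}) : succ_rel eta eta.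
Proof.
by apply/existsP; exists 1%g; apply/forallP => i; rewrite perm1 ltnn.
Qed.

(** If [i < s' (s i)], one of the two steps moves to the right and is strict. *)
Lemma succ_rel_trans n (eta mu la : 'X_{1..n}) :
  succ_rel eta mu -> succ_rel mu la -> succ_rel eta la.
Proof.
move=> /existsP [s /forallP hs] /existsP [s' /forallP hs']; apply/existsP.
exists (s * s')%g; apply/forallP => i; rewrite permM.
by move: (hs i) (hs' (s i)); do 3 case: ifP; lia.
Qed.

(** * Substitutions and divisibility *)

Section Substitution.
Variables (K : fieldType) (n : nat).
Implicit Types (l : 'I_n -> {mpoly K[n]}) (p d : {mpoly K[n]}).

Definition subst l p : {mpoly K[n]} := p \mPo [tuple l i | i < n].

Lemma subst_eval l p v : (subst l p).@[v] = p.@[fun i => (l i).@[v]].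
Proof. by rewrite comp_mpoly_meval; apply: meval_eq => i; rewrite tnth_mktuple. Qed.

Lemma substE l p : subst l p = \sum_(m <- msupp p) p@_m *: \prod_(i < n) l i ^+ m i.
Proof.
rewrite /subst comp_mpolyE; apply: eq_bigr => m _; congr (_ *: _).
by apply: eq_bigr => i _; rewrite tnth_mktuple.
Qed.

Lemma subst_X p : subst (fun i => 'X_i) p = p.
Proof. exact: comp_mpoly_id. Qed.

Lemma msize_subst l p : (forall i, msize (l i) <= 2)%N -> (msize (subst l p) <= msize p)%N.
Proof.
move=> hl; rewrite substE big_seq; apply: msize_sum_leq => m /msize_mdeg_lt.
apply: leq_trans; apply: leq_trans (msizeZ_le _ _) _; rewrite mdegE.
pose ok (f : {mpoly K[n]}) (e : nat) := (msize f <= e.+1)%N.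
have ok1 : ok 1 0%N by rewrite /ok -mpolyC1 msizeC leq_b1.
have okM f1 e1 f2 e2 : ok f1 e1 -> ok f2 e2 -> ok (f1 * f2) (e1 + e2)%N.
  by rewrite /ok -addnS; apply: msizeM_leq.
rewrite -/(ok _ _); apply: (big_ind2 ok) => // i _.
elim: (m i) => [|k IH]; first by rewrite expr0.
by rewrite exprS -add1n; apply: okM => //; apply: hl.
Qed.

(** Substitutions that agree modulo [d] on the variables agree modulo [d]
everywhere.  This single fact yields both the divided differences and the division by
a variable. *)
Lemma subst_congr l l' d p : (forall i, exists g, l i - l' i = d * g) ->
  exists g, subst l p - subst l' p = d * g.
Proof.
move=> hl; pose ok (f f' : {mpoly K[n]}) := exists g, f - f' = d * g.
have ok0 f : ok f f by exists 0; rewrite subrr mulr0.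
have okD f1 f1' f2 f2' : ok f1 f1' -> ok f2 f2' -> ok (f1 + f2) (f1' + f2').
  by move=> [g1 h1] [g2 h2]; exists (g1 + g2); rewrite mulrDr -h1 -h2; ring.
have okM f1 f1' f2 f2' : ok f1 f1' -> ok f2 f2' -> ok (f1 * f2) (f1' * f2').
  move=> [g1 h1] [g2 h2]; exists (g1 * f2 + f1' * g2).
  rewrite mulrDr mulrA -h1 [d * (_ * _)]mulrCA -h2; ring.
rewrite !substE -/(ok _ _); apply: (big_ind2 ok) => // m _.
rewrite -!mul_mpolyC; apply: (okM) => //.
apply: (big_ind2 ok) => // i _; elim: (m i) => [|k IH]; first by rewrite !expr0.
by rewrite !exprS; apply: okM => //; apply: hl.
Qed.

Lemma msize_var_le2 i : (msize ('X_i : {mpoly K[n]}) <= 2)%N.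
Proof. by rewrite msizeX mdeg1. Qed.

End Substitution.

(** Setting [z_i] to zero in [p] gives a polynomial that vanishes at all points, hence
is zero, and it is congruent to [p] modulo [z_i]. *)
Lemma dvd_var n (p : {mpoly Qqt[n]}) i :
  (forall v : 'I_n -> Qqt, v i = 0 -> p.@[v] = 0) ->
  exists2 g, p = 'X_i * g & (msize g <= (msize p).-1)%N.
Proof.
move=> h; pose l (k : 'I_n) : {mpoly Qqt[n]} := if k == i then 0 else 'X_k.
have h0 : subst l p = 0.
  apply: (@poly_eq0_of_spectral n (msize (subst l p))) => // mu _.
  by rewrite subst_eval; apply: h; rewrite /l eqxx meval0.
have [g] : exists g, subst (fun k => 'X_k) p - subst l p = 'X_i * g.
  apply: subst_congr => k; rewrite /l; case: eqP => [->|_].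
    by exists 1; rewrite subr0 mulr1.
  by exists 0; rewrite subrr mulr0.
rewrite h0 subr0 subst_X => hg; exists g => //.
have [->|nz_g] := eqVneq g 0; first by rewrite msize0.
rewrite hg msizeM ?msizeX ?mdeg1 //.
by rewrite -msize_poly_eq0 msizeX.
Qed.

(** * Hecke operators *)

Section Hecke.
Variables (n : nat) (a b : 'I_n).
Hypothesis neq_ab : a != b.
Implicit Types (p : {mpoly Qqt[n]}).

Definition swap p : {mpoly Qqt[n]} := subst (fun i => 'X_(tperm a b i)) p.

Lemma swap_eval p v : (swap p).@[v] = p.@[fun i => v (tperm a b i)].
Proof. by rewrite subst_eval; apply: meval_eq => i; rewrite mevalXU. Qed.

(** The quotient of [swap p - p] by [z_a - z_b], which exists by [subst_congr]. *)
Definition divided_difference p : {mpoly Qqt[n]} :=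
  epsilon (inhabits 0) (fun g => ('X_a - 'X_b) * g = swap p - p).

Lemma divided_differenceP p : ('X_a - 'X_b) * divided_difference p = swap p - p.
Proof.
apply: (epsilon_spec (inhabits 0) (fun g => ('X_a - 'X_b) * g = swap p - p)).
rewrite /swap -{2}(subst_X p).
have [i|g ->] := @subst_congr _ _ (fun i => 'X_(tperm a b i)) (fun i => 'X_i)
  ('X_a - 'X_b : {mpoly Qqt[n]}) p; last by exists g.
case: tpermP => [->|->|_ _].
- by exists (-1); rewrite mulrN1 opprB.
- by exists 1; rewrite mulr1.
- by exists 0; rewrite mulr0 subrr.
Qed.

Lemma divided_difference_eval p v :
  (v a - v b) * (divided_difference p).@[v] = p.@[fun i => v (tperm a b i)] - p.@[v].
Proof.
have := congr1 (meval v) (divided_differenceP p).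
by rewrite mevalM !mevalB !mevalXU swap_eval.
Qed.

Lemma msize_swap p : (msize (swap p) <= msize p)%N.
Proof. by apply: msize_subst => i; apply: msize_var_le2. Qed.

(** The Hecke operator [f |-> t f + (z_a - t z_b) (swap f - f) / (z_a - z_b)],
rewritten so that it visibly equals [t * swap f] modulo [z_a]. *)
Definition hecke p : {mpoly Qqt[n]} :=
  t *: swap p + (1 - t) *: ('X_a * divided_difference p).

Lemma hecke_eval p v : (hecke p).@[v] =
  t * p.@[fun i => v (tperm a b i)] + (1 - t) * (v a * (divided_difference p).@[v]).
Proof. by rewrite mevalD !mevalZ mevalM mevalXU swap_eval. Qed.

Lemma msize_hecke p : (msize (hecke p) <= msize p)%N.
Proof.
apply: msizeD_leq; apply: leq_trans (msizeZ_le _ _) _; first exact: msize_swap.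
have [->|nz_g] := eqVneq (divided_difference p) 0; first by rewrite mulr0 msize0.
have hab : (1 < msize ('X_a - 'X_b : {mpoly Qqt[n]}))%N.
  rewrite -(mdeg1 a); apply: msize_mdeg_lt.
  rewrite mcoeff_msupp mcoeffB !mcoeffXU eqxx.
  by rewrite [b == a]eq_sym (negbTE neq_ab) subr0 oner_eq0.
have nz_ab : 'X_a - 'X_b != 0 :> {mpoly Qqt[n]}.
  by rewrite -msize_poly_eq0 -lt0n; apply: ltnW.
have := msizeB_leq (msize_swap p) (leqnn (msize p)).
rewrite -divided_differenceP msizeM //.
have : (0 < msize (divided_difference p))%N by rewrite lt0n msize_poly_eq0.
rewrite msizeM ?msizeX ?mdeg1; [|by rewrite -msize_poly_eq0 msizeX|by []].
move: hab; set x := msize ('X_a - 'X_b); set y := msize (divided_difference p).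
by lia.
Qed.

Lemma hecke_eval0 p v : v a = 0 -> (hecke p).@[v] = t * p.@[fun i => v (tperm a b i)].
Proof. by move=> h; rewrite hecke_eval h mul0r mulr0 addr0. Qed.

(** The factor [z_a - t z_b] in front of the divided difference vanishes at such a
point. *)
Lemma hecke_eval_eq p v : v a = t * v b -> v a != v b -> (hecke p).@[v] = t * p.@[v].
Proof.
move=> hv hne; rewrite hecke_eval hv.
have : (t - 1) * v b != 0 by rewrite mulrBl mul1r -hv subr_eq0.
have := divided_difference_eval p v; rewrite hv => h _.
transitivity (t * p.@[fun i => v (tperm a b i)]
   - t * ((t * v b - v b) * (divided_difference p).@[v])); first by ring.
by rewrite h; ring.
Qed.

Lemma hecke_eval_neq0 p v : v a != v b -> (hecke p).@[v] != 0 ->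
  p.@[v] != 0 \/ p.@[fun i => v (tperm a b i)] != 0.
Proof.
move=> hne hp; case: (eqVneq p.@[v] 0) => [h1|]; last by left.
right; apply: contraNneq hp => h2; rewrite hecke_eval h2.
have /eqP := divided_difference_eval p v; rewrite h1 h2 subrr mulf_eq0 subr_eq0.
by rewrite (negbTE hne) => /eqP ->; rewrite !mulr0 addr0.
Qed.

End Hecke.

Lemma spectral_neq0 n (mu : 'X_{1..n}) i : spectral mu i != 0.
Proof.
apply: mulf_neq0; first by apply: expf_neq0; exact: q_neq0.
by apply: invr_neq0; exact: t_expr_neq0.
Qed.

(** * Cherednik operators *)

Section Cherednik.
Variable m : nat.
Implicit Types (mu nu la : 'X_{1..m.+1}) (p : {mpoly Qqt[m.+1]}).

Lemma pos_neq j : (j < m)%N -> pos m j != pos m j.+1.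
Proof.
move=> hj; apply/eqP => /(congr1 (@nat_of_ord _)).
by rewrite !posE //; lia.
Qed.

(** The factor vanishes at the points of compositions with zero last part, and is
[-1] at [z_n = 0].  At the point of any other [nu], the substituted point is that of
[lower nu]. *)
Definition raise p : {mpoly Qqt[m.+1]} :=
  (t ^+ m *: 'X_ord_max - 1) *
  subst (fun i => q ^- (i == ord0) *: 'X_(ord_pred i)) p.

Lemma raise_eval p v : (raise p).@[v] =
  (t ^+ m * v ord_max - 1) * p.@[fun i => v (ord_pred i) * q ^- (i == ord0)].
Proof.
rewrite mevalM mevalB mevalZ mevalXU meval1 subst_eval; congr (_ * _).
by apply: meval_eq => i; rewrite mevalZ mevalXU mulrC.
Qed.

Lemma msize_raise p : (msize (raise p) <= (msize p).+1)%N.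
Proof.
rewrite -[X in (_ <= X)%N]add1n; apply: msizeM_leq.
  apply: msizeB_leq; first by apply: leq_trans (msizeZ_le _ _) _; apply: msize_var_le2.
  by rewrite msize1.
apply: msize_subst => i; apply: leq_trans (msizeZ_le _ _) _; exact: msize_var_le2.
Qed.

Lemma raise_spectral_neq0 p nu : (raise p).@[spectral nu] != 0 ->
  (0 < nu ord_max)%N /\ p.@[spectral (lower nu)] != 0.
Proof.
rewrite raise_eval mulf_eq0 negb_or => /andP [h1 h2].
have hpos : (0 < nu ord_max)%N.
  rewrite lt0n; apply: contraNneq h1 => /spectral_last0 ->.
  by rewrite mulfV ?t_expr_neq0 // subrr.
split; first exact: hpos.
by rewrite (meval_eq p (spectral_lower hpos)); exact: h2.
Qed.

(** The Hecke operators at the adjacent positions listed in [s], the head of [s]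
being applied last. *)
Definition hecke_word (s : seq nat) p :=
  foldr (fun j => hecke (pos m j) (pos m j.+1)) p s.

Lemma msize_hecke_word s p : all (fun j => j < m)%N s -> (msize (hecke_word s p) <= msize p)%N.
Proof.
elim: s => //= j s IH /andP [hj hs].
by apply: leq_trans (IH hs); apply/msize_hecke/pos_neq.
Qed.

Lemma hecke_spectral_neq0 p nu j : (j < m)%N ->
  (hecke (pos m j) (pos m j.+1) p).@[spectral nu] != 0 ->
  p.@[spectral nu] != 0 \/ p.@[spectral (permute nu (adjacent m j))] != 0.
Proof.
move=> hj; have [heq|hne] := eqVneq (nu (pos m j)) (nu (pos m j.+1)).
  have h := spectral_adjacent_eq hj heq.
  rewrite (hecke_eval_eq _ h) ?mulf_eq0 ?negb_or => [/andP[]|]; first by left.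
  rewrite h -subr_eq0 (_ : _ - _ = (t - 1) * spectral nu (pos m j.+1)); last by ring.
  by apply: mulf_neq0; [exact: t_neq1 | exact: spectral_neq0].
have hne' : spectral nu (pos m j) != spectral nu (pos m j.+1).
  by apply: contra_neq hne; apply: q_expr_inj.
case/(hecke_eval_neq0 hne') => h; [by left|right].
by rewrite (meval_eq p (spectral_adjacent hj hne)).
Qed.

(** Unfolding a product of Hecke operators at a spectral point amounts to following a
chain of optional adjacent exchanges; [P] is any invariant of such chains, indexed by
the next position. *)
Lemma hecke_word_spectral_neq0 (P : nat -> 'X_{1..m.+1} -> Prop) J :
  (J <= m)%N ->
  (forall j nu, (j < J)%N -> P j nu -> P j.+1 nu /\ P j.+1 (permute nu (adjacent m j))) ->
  forall len j nu p, (j + len = J)%N -> P j nu ->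
    (hecke_word (iota j len) p).@[spectral nu] != 0 ->
    exists2 mu, P J mu & p.@[spectral mu] != 0.
Proof.
move=> hJ hP; elim=> [|len IH] j nu p hj hPj /= hp.
  by exists nu => //; rewrite -hj addn0.
have hjJ : (j < J)%N by lia.
have [h1 h2] := hP j nu hjJ hPj.
have hj' : (j.+1 + len = J)%N by lia.
by case: (hecke_spectral_neq0 (leq_trans hjJ hJ) hp); apply: IH.
Qed.

(** The cycle [i -> i + 1 -> ... -> j -> i] on natural numbers, which is the product
of the adjacent transpositions met in [hecke_word_eval0]. *)
Definition cycle_up (i j k : nat) : nat :=
  if (k < i)%N || (j < k)%N then k else if k == j then i else k.+1.

(** The coordinate that vanishes is carried along by the transpositions, so that every
Hecke operator of the word is evaluated where it only exchanges two variables. *)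
Lemma hecke_word_eval0 len i p (v : 'I_m.+1 -> Qqt) : (i + len <= m)%N ->
  v (pos m i) = 0 ->
  (hecke_word (iota i len) p).@[v] =
    t ^+ len * p.@[fun k => v (pos m (cycle_up i (i + len) k))].
Proof.
elim: len i v => [|len IH] i v hi hv /=.
  rewrite mul1r; apply: meval_eq => k; congr v; apply: val_inj => /=.
  by rewrite /cycle_up; case: ifP => h; [|case: ifP => h']; rewrite posE //; have := ltn_ord k; lia.
have him : (i < m)%N by lia.
rewrite hecke_eval0 // IH -/(adjacent m i) /adjacent ?tpermR //; last by lia.
rewrite exprS mulrA; congr (_ * _); apply: meval_eq => k; congr v.
have hk := ltn_ord k; apply: val_inj; rewrite -/(adjacent m i) /= adjacentE //.
rewrite !posE /cycle_up; do ?case: ifP; lia.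
Qed.

(** The word [H_i ... H_{n-1} Phi H_1 ... H_{i-1}], with positions counted
from [0]. *)
Definition cherednik_word (i : 'I_m.+1) p :=
  hecke_word (iota i (m - i)) (raise (hecke_word (iota 0 i) p)).

(** The three permutations of the variables, two cycles and the rotation of [raise],
compose to the identity; the factor of [raise] gives the sign. *)
Lemma cherednik_word_eval0 i p v : v i = 0 -> (cherednik_word i p).@[v] = - t ^+ m * p.@[v].
Proof.
move=> hv; have him : (i <= m)%N by rewrite -ltnS.
have posi : pos m i = i by apply: val_inj; rewrite /= posE.
rewrite /cherednik_word hecke_word_eval0 ?posi ?subnKC // raise_eval.
have hmax : cycle_up i m (ord_max : 'I_m.+1) = i.
  by rewrite /cycle_up /= ltnn orbF eqxx; case: ifP => //; lia.
rewrite hmax posi hv mulr0 sub0r hecke_word_eval0 //; last first.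
  rewrite (_ : pos m 0 = ord0) ?ord_pred0 ?hmax ?posi ?hv ?mul0r //.
  by apply: val_inj; rewrite /= posE.
rewrite add0n mulN1r mulrN mulrA -exprD subnK // mulNr; congr (- (_ * _)).
apply: meval_eq => k; have hk := ltn_ord k.
have [->|hki] := eqVneq k i.
  have h0 : cycle_up 0 i i = 0%N by rewrite /cycle_up ltnn ltn0 eqxx.
  rewrite h0 (_ : pos m 0 = ord0) ?ord_pred0 ?hmax ?posi ?hv ?mul0r //.
  by apply: val_inj; rewrite /= posE.
have {}hki : nat_of_ord k != i by [].
have hk' : nat_of_ord (pos m (cycle_up 0 i k)) = if (k < i)%N then k.+1 else k.
  by rewrite posE /cycle_up; do ?case: ifP; lia.
have -> : (pos m (cycle_up 0 i k) == ord0) = false.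
  by apply/negbTE; rewrite -val_eqE /= hk'; case: ifP; lia.
rewrite expr0 invr1 mulr1; congr v; apply: val_inj.
set c := ord_pred _; have hc : nat_of_ord c = if (k < i)%N then nat_of_ord k else k.-1.
  by rewrite /c ord_predE -val_eqE /= hk'; do ?case: ifP; lia.
have hcc : cycle_up i m c = k by rewrite /cycle_up hc; do ?case: ifP; lia.
by rewrite hcc; apply: posE; rewrite -ltnS.
Qed.

(** Starting from [la], optional exchanges carry a part rightwards from position [i]
to the end, the last part loses a box and moves to the front, and optional exchanges
carry a part from the front to position [i].  A skipped exchange changes the part
being carried and leaves the former one behind.  Apart from the part that lost
a box, no part ends to the left of its original position, so the strict inequalities
required by [succ_rel] concern that part only.  [P1] and [P2] express this
before and after the box is removed. *)
Lemma cherednik_word_spectral_neq0 i p la : (cherednik_word i p).@[spectral la] != 0 ->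
  exists mu, [/\ mdeg la = (mdeg mu).+1, succ_rel mu la & p.@[spectral mu] != 0].
Proof.
pose P1 j nu := [/\ (i <= j)%N, mdeg nu = mdeg la & exists s : 'S_m.+1, forall k,
  [/\ nu k = la (s k), (s k <= k.+1)%N & (k < i)%N || (j < k)%N -> s k = k]].
pose P2 (j : nat) mu := mdeg la = (mdeg mu).+1 /\ exists s : 'S_m.+1, forall k : 'I_m.+1,
  (if (k < s k)%N then (mu k < la (s k))%N else (mu k <= la (s k))%N) /\
  ((j < k)%N -> (k <= i)%N -> (s k).+1 = k :> nat).
have him : (i <= m)%N by rewrite -ltnS.
have mdeg_permute mu (s : 'S_m.+1) : mdeg (permute mu s) = mdeg mu by apply: mdeg_mperm.
move=> hla.
(* From the part at position [i] to the last position. *)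
have [|||nu [_ hdeg [s hs]]] := @hecke_word_spectral_neq0 P1 m (leqnn m) _ (m - i) i la _ _ _ hla.
- move=> j nu hj [hij hdeg [s hs]]; split.
    split=> //; first exact: leqW.
    exists s => k; have [h1 h2 h3] := hs k; split=> // hk; apply: h3.
    by move: hk; lia.
  split; [exact: leqW | by rewrite mdeg_permute|].
  exists (adjacent m j * s)%g => k; rewrite permM mnmE.
  have [h1 h2 h3] := hs (adjacent m j k); split=> //.
    have e := adjacentE k hj; have [kj|kj] := eqVneq (nat_of_ord k) j.
      by rewrite h3 e kj ?eqxx //; lia.
    by move: h2 e; rewrite (negbTE kj); case: ifP; lia.
  move=> hk; have e : adjacent m j k = k by apply: adjacent_id => //; lia.
  by rewrite h3 e //; move: hk; lia.
- by rewrite subnKC.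
- split=> //; exists 1%g => k; rewrite perm1; split=> //.
case/raise_spectral_neq0 => hpos hlow.
(* From the front to position [i]. *)
have [|||mu [hmu [s' hs']] hp] :=
  @hecke_word_spectral_neq0 P2 i him _ i 0%N (lower nu) _ _ _ hlow.
- move=> j mu hj [hdeg' [s' hs']]; split.
    split=> //; exists s' => k; have [h1 h2] := hs' k; split=> // hk.
    by apply: h2; lia.
  split; first by rewrite mdeg_permute.
  exists (adjacent m j * s')%g => k; rewrite permM mnmE.
  have hjm : (j < m)%N by lia.
  have [h1 h2] := hs' (adjacent m j k); have e := adjacentE k hjm; split; last first.
    by move=> hk1 hk2; have ek : adjacent m j k = k by [apply: adjacent_id => //; lia];
      rewrite ek in h2 *; apply: h2; lia.
  move: h1 h2 e; case: eqP => [->|hkj]; last case: eqP => [->|hkj'].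
  - move=> h1 h2 e; have e' : (s' (adjacent m j k)).+1 = j.+1 by rewrite h2 e //; lia.
    by move: h1; rewrite e; do ?case: ifP; lia.
  - by move=> h1 _ e; move: h1; rewrite e; do ?case: ifP; lia.
  - by move=> h1 _ e; move: h1; rewrite e; do ?case: ifP; lia.
- by [].
- split; first by rewrite -hdeg; apply: mdeg_lower.
  exists (perm (@ord_pred_inj m.+1) * s)%g => k; rewrite permM permE mnmE.
  have [h1 h2 h3] := hs (ord_pred k); rewrite h1; split.
    case: eqP => [->|hk].
      have : (0 < la (s (ord_pred ord0)))%N.
        by have [<- _ _] := hs (ord_pred ord0); rewrite ord_pred0.
      by case: ifP; lia.
    have ek := ord_predE k; move: ek; case: eqP => // _ ek.
    have : nat_of_ord k != 0%N by apply/eqP => h; apply: hk; apply: val_inj.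
    by move: h2; rewrite ek; case: ifP; lia.
  move=> hk0 hki; have ek := ord_predE k.
  have ek' : nat_of_ord (ord_pred k) = k.-1.
    by rewrite ek; case: eqP hk0 => [->|].
  by rewrite h3 ek' ?prednK //; lia.
exists mu; split=> //; apply/existsP; exists s'; apply/forallP => k.
by have [] := hs' k.
Qed.

(** The polynomial [r] is the image of [p] under [Xi_i]. *)
Lemma cherednik_operator i p : exists2 r : {mpoly Qqt[m.+1]},
  (msize r <= msize p)%N &
  forall v, v i * r.@[v] = t ^+ m * p.@[v] + (cherednik_word i p).@[v].
Proof.
have [v hv|r hr hs] := @dvd_var _ (t ^+ m *: p + cherednik_word i p) i.
  by rewrite mevalD mevalZ cherednik_word_eval0 // mulNr subrr.
have him : (i <= m)%N by rewrite -ltnS.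
exists r => [|v].
  apply: leq_trans hs _; rewrite -subn1 leq_subLR add1n.
  apply: msizeD_leq; first by apply: leq_trans (msizeZ_le _ _) _; apply: leqnSn.
  apply: leq_trans (msize_hecke_word _ _) _.
    by apply/allP => j; rewrite mem_iota; lia.
  apply: leq_trans (msize_raise _) _; rewrite ltnS; apply: msize_hecke_word.
  by apply/allP => j; rewrite mem_iota; lia.
by have := congr1 (meval v) hr; rewrite mevalD mevalZ mevalM mevalXU.
Qed.

End Cherednik.

(** * Extra vanishing *)

Lemma interp_macdonald_vanish n (eta mu : 'X_{1..n}) :
  mu != eta -> (mdeg mu <= mdeg eta)%N -> (interp_macdonald eta).@[spectral mu] = 0.
Proof. by have [_ h _] := interp_macdonaldP eta; apply: h. Qed.

Lemma msize_interp_macdonald n (eta : 'X_{1..n}) :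
  (msize (interp_macdonald eta) <= (mdeg eta).+1)%N.
Proof. by have [] := interp_macdonaldP eta. Qed.

(** Cleared of the denominator [z_i], this is [Xi_i E = (t ^ m / eta_i) E], where
[eta_i] is the [i]-th coordinate of the point of [eta].
At a point of modulus at most [|eta|] the word only involves values of
[E_eta] at points of smaller modulus, which are zero; so both sides agree at
all these points, and have degree at most [|eta|] after division by [z_i]. *)
Lemma interp_macdonald_eigen m (eta : 'X_{1..m.+1}) (i : 'I_m.+1) v :
  v i * (t ^+ m / spectral eta i * (interp_macdonald eta).@[v]) =
  t ^+ m * (interp_macdonald eta).@[v] +
  (cherednik_word i (interp_macdonald eta)).@[v].
Proof.
set E := interp_macdonald eta.
have [r hsize hr] := cherednik_operator i E.
set c := t ^+ m / spectral eta i.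
suff hrc : r - c *: E = 0.
  by rewrite -hr -mevalZ; move/eqP: hrc; rewrite subr_eq0 => /eqP <-.
apply: (@poly_eq0_of_spectral _ (mdeg eta)).
  apply: msizeB_leq; first exact: leq_trans hsize (msize_interp_macdonald eta).
  exact: leq_trans (msizeZ_le _ _) (msize_interp_macdonald eta).
move=> mu hmu; have hword : (cherednik_word i E).@[spectral mu] = 0.
  apply/eqP; apply: contraT => /cherednik_word_spectral_neq0 [nu [hnu _]].
  rewrite interp_macdonald_vanish ?eqxx //; last by lia.
  by apply/eqP => h; move: hmu; rewrite hnu h ltnn.
rewrite mevalB mevalZ; apply: (mulfI (spectral_neq0 mu i)).
rewrite mulr0 mulrBr hr hword addr0.
have [->|hne] := eqVneq mu eta; last first.
  by rewrite interp_macdonald_vanish // !mulr0 subrr.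
by rewrite /c mulrA mulrCA mulfV ?spectral_neq0 // mulr1 subrr.
Qed.

Lemma eigen_gap (K : fieldType) (a b c x : K) : b != 0 ->
  a * (c / b * x) - c * x = c / b * x * (a - b).
Proof. by move=> hb; field. Qed.

(** Comparing the eigenvalue of [E_eta] with the scalar by which [Xi_i] acts at
[la] shows that the word does not vanish there, whence a predecessor of [la] at which
[E_eta] does not vanish. *)
Lemma interp_macdonald_extra_vanishing n (eta la : 'X_{1..n}) :
  (interp_macdonald eta).@[spectral la] != 0 -> succ_rel eta la.
Proof.
case: n eta la => [|m] eta la.
  by move=> _; rewrite (_ : la = eta) ?succ_rel_refl //; apply/mnmP => - [].
move: {2}(mdeg la) (erefl (mdeg la)) => k; elim/ltn_ind: k la => k IH la hk hnz.
have [->|hne] := eqVneq la eta; first exact: succ_rel_refl.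
have [i hi] : exists i, la i != eta i.
  by apply/existsP; rewrite -negb_forall; apply: contraNN hne => /forallP h;
     apply/eqP/mnmP => i; apply/eqP.
have hw : (cherednik_word i (interp_macdonald eta)).@[spectral la] != 0.
  have := interp_macdonald_eigen eta i (spectral la).
  apply: contra_eqN => /eqP ->; rewrite addr0 -subr_eq0.
  rewrite (_ : _ - _ = t ^+ m / spectral eta i * (interp_macdonald eta).@[spectral la]
      * (spectral la i - spectral eta i)).
    apply: mulf_neq0; last first.
      by rewrite subr_eq0; apply: contra_neq hi; apply: q_expr_inj.
    apply: mulf_neq0; last exact: hnz.
    by apply: mulf_neq0; [|apply: invr_neq0]; [exact: t_expr_neq0|exact: spectral_neq0].
  by apply: eigen_gap; exact: spectral_neq0.
have [mu [hmu hsucc hE]] := cherednik_word_spectral_neq0 hw.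
by apply: succ_rel_trans hsucc; apply: (IH (mdeg mu)) => //; lia.
Qed.

(** * The expansion and its coefficients *)

(** Subtract the combination of the [E_la] with [|la| = a + 1] that has the values of
[f] at the points of modulus [a + 1]; the difference vanishes one degree further. *)
Lemma interp_expansion n a k (f : {mpoly Qqt[n]}) :
  (msize f <= (a + k).+1)%N ->
  (forall mu : 'X_{1..n}, (mdeg mu <= a)%N -> f.@[spectral mu] = 0) ->
  exists A : 'X_{1..n} -> Qqt,
    f = \sum_(la : 'X_{1..n < (a + k).+1} | (a + 1 <= mdeg la)%N)
          A la *: interp_macdonald la.
Proof.
elim: k a f => [|k IH] a f hf h.
  exists (fun=> 0); rewrite big1 => [|la _]; last by rewrite scale0r.
  by apply: (poly_eq0_of_spectral hf) => mu; rewrite addn0; apply: h.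
pose B (la : 'X_{1..n}) :=
  f.@[spectral la] / (interp_macdonald la).@[spectral la].
pose g := \sum_(la : 'X_{1..n < (a + k.+1).+1} | mdeg la == a.+1)
  B la *: interp_macdonald la.
have [||A hA] := IH a.+1 (f - g).
- apply: msizeB_leq; first by rewrite addSnnS.
  apply: msize_sum_leq => la /eqP hla; apply: leq_trans (msizeZ_le _ _) _.
  by apply: leq_trans (msize_interp_macdonald _) _; rewrite hla; lia.
- move=> mu hmu; have -> : (f - g).@[spectral mu] = f.@[spectral mu] -
     \sum_(la : 'X_{1..n < (a + k.+1).+1} | mdeg la == a.+1)
        B la * (interp_macdonald la).@[spectral mu].
    rewrite mevalB /g; congr (_ - _); rewrite (raddf_sum (meval _)) /=.
    by apply: eq_bigr => la _; rewrite mevalZ.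
  have [hle|hgt] := leqP (mdeg mu) a.
    rewrite (h _ hle) big1 ?subr0 // => la /eqP hla.
    rewrite interp_macdonald_vanish ?mulr0 //; last by lia.
    by apply/eqP => e; move: hle; rewrite e; lia.
  have hmu' : (mdeg mu < (a + k.+1).+1)%N by lia.
  rewrite (bigD1 (BMultinom hmu')) /=; last by lia.
  rewrite big1 ?addr0 => [|la /andP [/eqP hla hne]].
    by rewrite /B mulfVK ?subrr // interp_macdonald_neq0.
  rewrite interp_macdonald_vanish ?mulr0 //; last by lia.
  by rewrite eq_sym.
exists (fun la => if mdeg la == a.+1 then B la else A la).
transitivity (g + (f - g)); first by rewrite addrC subrK.
rewrite hA [RHS](bigID (fun la : 'X_{1..n < _} => mdeg la == a.+1)) /=.
congr (_ + _).
  apply: eq_big => [la|la /eqP hla]; last by rewrite hla eqxx.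
  by case: eqP => [->|]; rewrite ?andbF ?andbT //; lia.
rewrite -(addSnnS a k); apply: eq_big => [la|la]; first by lia.
by case: eqP => // ->; rewrite addn1 ltnn.
Qed.

Lemma msize_mesym n r : (msize (mesym n Qqt r) <= r.+1)%N.
Proof.
rewrite mesymE; apply: msize_sum_leq => h /eqP hh.
by rewrite msizeX mdeg_mesym1 hh.
Qed.

(** At points of modulus at most [|eta|] the left-hand side vanishes: away from [eta]
because of [E_eta], and at [eta] because of the other factor. *)
Lemma pieri_expansion_exists n r (eta : 'X_{1..n}) :
  exists A : 'X_{1..n} -> Qqt, is_pieri_expansion r eta A.
Proof.
apply: interp_expansion => [|mu hmu].
  rewrite addnC -addnS; apply: msizeM_leq; last exact: msize_interp_macdonald.
  apply: msizeB_leq; first exact: msize_mesym.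
  by rewrite msizeC; case: (_ != 0).
rewrite mevalM mevalB mevalC.
have [->|hne] := eqVneq mu eta; first by rewrite subrr mul0r.
by rewrite interp_macdonald_vanish // mulr0.
Qed.

Lemma big_bmnm_narrow (V : nmodType) n b b' (P : pred 'X_{1..n}) (F : 'X_{1..n} -> V) :
  (b <= b')%N -> (forall mu, P mu -> (mdeg mu < b)%N) ->
  \sum_(mu : 'X_{1..n < b'} | P mu) F mu = \sum_(mu : 'X_{1..n < b} | P mu) F mu.
Proof.
move=> hb hP; pose widen (mu : 'X_{1..n < b}) : 'X_{1..n < b'} :=
  BMultinom (leq_trans (bmdeg mu) hb).
rewrite (reindex_omap widen (fun mu => insub (bmnm mu))) /= => [|mu /hP hmu].
  by apply: eq_bigl => mu; rewrite valK eqxx andbT.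
by rewrite insubT /=; congr Some; apply: val_inj.
Qed.

Section Recursion.
Variables (n r : nat) (eta : 'X_{1..n}) (A : 'X_{1..n} -> Qqt).
Hypothesis hA : is_pieri_expansion r eta A.

(** The expansion evaluated at the point of [la], where the defining zeros of the
[E_mu] remove all terms with [|mu| >= |la|] except that of [la]. *)
Lemma pieri_triangular i (la : 'X_{1..n}) : (1 <= i <= r)%N ->
  mdeg la = (mdeg eta + i)%N ->
  ((mesym n Qqt r).@[spectral la] - (mesym n Qqt r).@[spectral eta])
     * (interp_macdonald eta).@[spectral la] =
  A la * (interp_macdonald la).@[spectral la] +
  \sum_(1 <= k < i)
     \sum_(mu : 'X_{1..n < (mdeg la).+1} | mdeg mu == (mdeg eta + k)%N)
       A mu * (interp_macdonald mu).@[spectral la].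
Proof.
move=> hi hla; have := congr1 (meval (spectral la)) hA.
rewrite mevalM mevalB mevalC => ->; rewrite raddf_sum /=.
have hlar : (mdeg la < (mdeg eta + r).+1)%N by lia.
rewrite (bigD1 (BMultinom hlar)) /=; last by lia.
rewrite mevalZ; congr (_ + _).
transitivity (\sum_(mu : 'X_{1..n < (mdeg eta + r).+1} |
    (mdeg eta < mdeg mu < mdeg la)%N) A mu * (interp_macdonald mu).@[spectral la]).
  rewrite [RHS]big_mkcond [LHS]big_mkcond; apply: eq_bigr => mu _ /=.
  rewrite mevalZ addn1 -(inj_eq val_inj) /=.
  have [->|hne] := eqVneq (mu : 'X_{1..n}) la; first by rewrite ltnn !andbF.
  rewrite andbT; case: (mdeg eta < mdeg mu)%N => //=.
  by case: ltnP => // hle; rewrite interp_macdonald_vanish ?mulr0 // eq_sym.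
rewrite (@big_bmnm_narrow _ n (mdeg la).+1 _
  (fun mu => (mdeg eta < mdeg mu < mdeg la)%N)
  (fun mu => A mu * (interp_macdonald mu).@[spectral la])) //; last first.
  by move=> mu /andP [_ /ltnW].
rewrite big_mkcond (exchange_big_dep predT) //=; apply: eq_bigr => mu _.
case: ifP => hmu; last by rewrite big_nat_cond big_pred0 // => k; lia.
rewrite big_mkcond (bigD1_seq (mdeg mu - mdeg eta)%N) ?iota_uniq //=; last first.
  by rewrite mem_index_iota; lia.
rewrite ifT; last by lia.
by rewrite big1 ?addr0 // => k hk; rewrite ifF //; lia.
Qed.

(** In the triangular system a term indexed by [mu] can only survive if
[eta <=' mu] (by induction) and [mu <=' la] (by extra vanishing), and then
[eta <=' la]. *)
Lemma pieri_eq0 i (la : 'X_{1..n}) : (1 <= i <= r)%N ->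
  mdeg la = (mdeg eta + i)%N -> ~~ succ_rel eta la -> A la = 0.
Proof.
elim/ltn_ind: i la => i IH la hi hla hsucc.
have hE : (interp_macdonald eta).@[spectral la] = 0.
  by apply/eqP; apply: contraNT hsucc; apply: interp_macdonald_extra_vanishing.
have := pieri_triangular hi hla; rewrite hE mulr0 big_nat_cond big1 ?addr0.
  move/eqP; rewrite eq_sym mulf_eq0 (negbTE (interp_macdonald_neq0 la)) orbF.
  by move/eqP.
move=> k /andP [hk _]; apply: big1 => mu /eqP hmu.
have [hem|hem] := boolP (succ_rel eta mu); last first.
  by rewrite (IH k _ mu _ hmu hem) ?mul0r //; lia.
have -> : (interp_macdonald mu).@[spectral la] = 0; last by rewrite mulr0.
apply/eqP; apply: contraNT hsucc => /interp_macdonald_extra_vanishing.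
exact: succ_rel_trans.
Qed.

(** Division by the value of [E_la] at its own point; the terms missing from the
restricted inner sum are zero. *)
Lemma pieri_recursion i (la : 'X_{1..n}) : (1 <= i <= r)%N ->
  mdeg la = (mdeg eta + i)%N ->
  A la =
    ((mesym n Qqt r).@[spectral la] - (mesym n Qqt r).@[spectral eta])
      * (interp_macdonald eta).@[spectral la] / (interp_macdonald la).@[spectral la]
    - \sum_(1 <= k < i)
        \sum_(mu : 'X_{1..n < (mdeg la).+1} |
                [&& mdeg mu == (mdeg eta + k)%N, succ_rel eta mu & succ_rel mu la])
          A mu * ((interp_macdonald mu).@[spectral la]
                  / (interp_macdonald la).@[spectral la]).
Proof.
move=> hi hla; rewrite (pieri_triangular hi hla) mulrDl mulfK ?interp_macdonald_neq0 //.
rewrite mulr_suml -addrA -sumrB big_nat_cond big1 ?addr0 // => k /andP [hk _].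
apply/eqP; rewrite subr_eq0 mulr_suml; apply/eqP.
rewrite big_mkcond [RHS]big_mkcond; apply: eq_bigr => mu _ /=.
case: eqP => //= hmu; rewrite -mulrA.
have [hem|hem] := boolP (succ_rel eta mu) => /=; last first.
  by rewrite (@pieri_eq0 k) ?mul0r //; lia.
have [//|hml] := boolP (succ_rel mu la).
have -> : (interp_macdonald mu).@[spectral la] = 0; last by rewrite mul0r mulr0.
by apply/eqP; apply: contraNT hml; apply: interp_macdonald_extra_vanishing.
Qed.

End Recursion.

Theorem theorem7 (n r : nat) (eta : 'X_{1..n})
    (hn : (1 <= n)%N) (hr : (1 <= r <= n)%N) :
  (exists A : 'X_{1..n} -> Qqt, is_pieri_expansion r eta A) /\
  forall A : 'X_{1..n} -> Qqt, is_pieri_expansion r eta A ->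
  forall (i : nat) (lambda : 'X_{1..n}),
    (1 <= i <= r)%N -> mdeg lambda = (mdeg eta + i)%N ->
    (succ_rel eta lambda ->
       A lambda =
         ((mesym n Qqt r).@[spectral lambda] - (mesym n Qqt r).@[spectral eta])
           * (interp_macdonald eta).@[spectral lambda]
           / (interp_macdonald lambda).@[spectral lambda]
         - \sum_(1 <= k < i)
             \sum_(mu : 'X_{1..n < (mdeg lambda).+1} |
                     [&& mdeg mu == (mdeg eta + k)%N,
                         succ_rel eta mu & succ_rel mu lambda])
               A mu * ((interp_macdonald mu).@[spectral lambda]
                       / (interp_macdonald lambda).@[spectral lambda]))
    /\ (~~ succ_rel eta lambda -> A lambda = 0).
Proof.
split; first exact: pieri_expansion_exists.
move=> A hA i lambda hi hdeg; split=> [_|].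
  exact: (pieri_recursion hA hi hdeg).
exact: (pieri_eq0 hA hi hdeg).
Qed.
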